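(* Let $(S_n)_{n\ge1}$ be a demimartingale or a demisubmartingale. Let $r$ and $M$ be fixed integers with $1\le r<M$, and let $\tau$ be a bounded stopping time satisfying $r\le\tau\le M$ a.s. Assume that, for every $i=r+1,\ldots,M$, the indicator $I\{\tau\ge i\}$ is a componentwise nondecreasing function of $S_1,\ldots,S_{i-1}$. Then the pair $(S_r,S_\tau)$ is a demisubmartingale, and therefore $E(S_r)\le E(S_\tau)$.
   Context: All random variables live on one probability space, and functions are understood to be Borel measurable. $I\{A\}$ denotes the indicator of the event $A$. A sequence of $L^1$ random variables $(S_n)_{n\ge1}$ is a demimartingale if for all $j\ge1$, $E[(S_{j+1}-S_j)f(S_1,\ldots,S_j)]\ge 0$ for all componentwise nondecreasing functions $f:\mathbb{R}^j\to\mathbb{R}$ for which the expectation is defined; it is a demisubmartingale if this is required only for nonnegative componentwise nondecreasing $f$. A pair $(T_1,T_2)$ of $L^1$ random variables is a demisubmartingale if $E[(T_2-T_1)f(T_1)]\ge0$ for every nonnegative nondecreasing $f:\mathbb{R}\to\mathbb{R}$ for which the expectation is defined. A stopping time is a random variable $\tau$ with values in $\{1,2,\ldots\}\cup\{\infty\}$ with $\{\tau\le j\}\in\sigma(S_1,\ldots,S_j)$ for every $j\ge1$. ''$I\{A\}$ is a componentwise nondecreasing function of $S_1,\ldots,S_k$'' means $I\{A\}=h(S_1,\ldots,S_k)$ for some componentwise nondecreasing function $h$ on $\mathbb{R}^k$. *)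

(* Defs.v *)
From HB Require Import structures.
From mathcomp Require Import all_boot all_order all_algebra.
From mathcomp Require Import all_classical all_reals all_analysis.

Set Implicit Arguments.
Unset Strict Implicit.
Unset Printing Implicit Defensive.

Import Order.TTheory GRing.Theory Num.Theory.

Local Open Scope classical_set_scope.
Local Open Scope ring_scope.

(* A process (S_n)_{n >= 1} is a function S : nat -> T -> R whose value at
   index 0 is never used. *)

Definition cw_nondecreasing (R : realType) (k : nat) (f : k.-tuple R -> R) :=
  forall x y : k.-tuple R,
    (forall i : 'I_k, tnth x i <= tnth y i) -> f x <= f y.

(* history S k w = (S_1(w), ..., S_k(w)); the measurable structure of
   k.-tuple R is the product, i.e. Borel, sigma-algebra of R^k. *)
Definition history (T : Type) (R : realType) (S : nat -> T -> R) (k : nat)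
    (w : T) : k.-tuple R :=
  [tuple S i.+1 w | i < k].

(* The expectation exists in [-oo, +oo]: E[X^+] and E[X^-] are not both
   infinite. *)
Definition expectation_defined d (T : measurableType d) (R : realType)
    (P : probability T R) (X : T -> R) :=
  measurable_fun setT X /\
  (('E_P[X^\+] < +oo)%E \/ ('E_P[X^\-] < +oo)%E).

Definition demimartingale d (T : measurableType d) (R : realType)
    (P : probability T R) (S : nat -> T -> R) :=
  (forall n, (1 <= n)%N -> S n \in Lfun P 1) /\
  (forall j, (1 <= j)%N -> forall f : j.-tuple R -> R,
     measurable_fun setT f -> cw_nondecreasing f ->
     let X := fun w => (S j.+1 w - S j w) * f (history S j w) in
     expectation_defined P X -> (0 <= 'E_P[X])%E).

Definition demisubmartingale d (T : measurableType d) (R : realType)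
    (P : probability T R) (S : nat -> T -> R) :=
  (forall n, (1 <= n)%N -> S n \in Lfun P 1) /\
  (forall j, (1 <= j)%N -> forall f : j.-tuple R -> R,
     measurable_fun setT f -> cw_nondecreasing f -> (forall x, 0 <= f x) ->
     let X := fun w => (S j.+1 w - S j w) * f (history S j w) in
     expectation_defined P X -> (0 <= 'E_P[X])%E).

Definition demisubmartingale_pair d (T : measurableType d) (R : realType)
    (P : probability T R) (T1 T2 : T -> R) :=
  [/\ T1 \in Lfun P 1, T2 \in Lfun P 1 &
   forall f : R -> R,
     measurable_fun setT f -> {homo f : x y / x <= y} -> (forall x, 0 <= f x) ->
     let X := fun w => (T2 w - T1 w) * f (T1 w) in
     expectation_defined P X -> (0 <= 'E_P[X])%E].

(* Random times take values in option nat, with None standing for infinity. *)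
Definition time_le (t : option nat) (j : nat) : bool :=
  if t is Some n then (n <= j)%N else false.

Definition time_ge (t : option nat) (i : nat) : bool :=
  if t is Some n then (i <= n)%N else true.

Definition stopping_time (T : Type) (R : realType) (S : nat -> T -> R)
    (tau : T -> option nat) :=
  (forall w, tau w != Some 0%N) /\
  (forall j, (1 <= j)%N ->
     g_sigma_preimage (fun i : 'I_j => S i.+1) [set w | time_le (tau w) j]).

(* S_tau, with the conventional value 0 on {tau = oo}. *)
Definition stopped (T : Type) (R : realType) (S : nat -> T -> R)
    (tau : T -> option nat) (w : T) : R :=
  if tau w is Some n then S n w else 0.

Definition indic_nondecreasing_function_of (T : Type) (R : realType)
    (S : nat -> T -> R) (k : nat) (A : set T) :=
  exists h : k.-tuple R -> R,
    [/\ measurable_fun setT h, cw_nondecreasing h &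
        forall w, \1_A w = h (history S k w)].

(* Main.v *)
Require Import Defs.
From HB Require Import structures.
From mathcomp Require Import all_boot all_order all_algebra.
From mathcomp Require Import all_classical all_reals all_analysis measurable_realfun.

(** On the almost sure event r <= tau <= M the difference S_tau - S_r is a
    finite sum of increments stopped at tau,
      S_tau - S_r = sum over r <= k < M of (S_(k+1) - S_k) 1_{tau >= k+1}
    (lemma [stopped_telescope]).  If f is nonnegative and nondecreasing, then
    f(S_r) 1_{tau >= k+1} is a nonnegative nondecreasing function of
    S_1, ..., S_k, because k >= r and the indicator is such a function by
    hypothesis; the demisubmartingale inequality at time k therefore makes
    every term of E[(S_tau - S_r) f(S_r)] nonnegative
    (lemma [demisubmartingale_increment_ge0]).

    Splitting the expectation over the sum needs every term to be integrable,
    which holds when f is bounded.  For an unbounded f, the inequality for the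
    truncations min(f, n) says that E[D^- min(f(S_r), n)] is at most
    E[D^+ min(f(S_r), n)], where D = S_tau - S_r; by monotone convergence this
    passes to the limit in [0, +oo], and the expectation of D f(S_r), being
    defined, is the difference of the two limits
    (lemma [expectation_ge0_truncate]).  The comparison of the expectations is
    the case f = 1. *)

Set Implicit Arguments.
Unset Strict Implicit.

Import Order.TTheory GRing.Theory Num.Theory.

Local Open Scope classical_set_scope.
Local Open Scope ring_scope.

(** * Integrable random variables *)

Lemma Lfun1_measurable d (T : measurableType d) (R : realType)
    (P : probability T R) (X : T -> R) :
  X \in Lfun P 1 -> measurable_fun setT X.
Proof.
by move=> /Lfun1_integrable/measurable_int/measurable_EFinP.
Qed.

Lemma Lfun1M_bounded d (T : measurableType d) (R : realType)
    (P : probability T R) (X g : T -> R) (c : R) :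
  X \in Lfun P 1 -> measurable_fun setT g -> (forall w, `|g w| <= c) ->
  (fun w => X w * g w) \in Lfun P 1.
Proof.
move=> XL mg gc; apply/Lfun1_integrable.
apply: (le_integrable measurableT (g := fun w => (c%:E * (X w)%:E)%E)).
- apply/measurable_EFinP/measurable_funM => //; exact: Lfun1_measurable XL.
- move=> w _ /=; rewrite lee_fin normrM [leRHS]normrM mulrC ler_wpM2r//.
  by rewrite (le_trans (gc w))// ler_norm.
- by apply: integrableZl => //; apply/Lfun1_integrable.
Qed.

Lemma Lfun1_ae_eq d (T : measurableType d) (R : realType)
    (P : probability T R) (X Y : T -> R) :
  measurable_fun setT X -> Y \in Lfun P 1 -> {ae P, forall w, X w = Y w} ->
  X \in Lfun P 1.
Proof.
move=> mX YL XY; apply/Lfun1_integrable/integrableP.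
split; first exact/measurable_EFinP.
have /integrableP[mY Yoo] := (Lfun1_integrable _ _).1 YL.
rewrite (le_lt_trans _ Yoo)//; apply: ae_ge0_le_integral => //.
- by apply: measurableT_comp => //; exact/measurable_EFinP.
- exact: measurableT_comp.
- by apply: filterS XY => w /= -> _.
Qed.

Lemma expectation_ae_eq d (T : measurableType d) (R : realType)
    (P : probability T R) (X Y : T -> R) :
  measurable_fun setT X -> measurable_fun setT Y ->
  {ae P, forall w, X w = Y w} -> ('E_P[X] = 'E_P[Y])%E.
Proof.
move=> mX mY XY; rewrite unlock; apply: ae_eq_integral => //.
- exact/measurable_EFinP.
- exact/measurable_EFinP.
- by apply: filterS XY => w /= -> _.
Qed.

Lemma Lfun1_sum d (T : measurableType d) (R : realType)
    (P : probability T R) (m n : nat) (X : nat -> T -> R) :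
  (forall k, (m <= k < n)%N -> X k \in Lfun P 1) ->
  (fun w => \sum_(m <= k < n) X k w) \in Lfun P 1.
Proof.
move=> XL; rewrite -(fct_sumE _ _ X).
by rewrite big_nat; apply: rpred_sum.
Qed.

Lemma expectation_sum_ge0 d (T : measurableType d) (R : realType)
    (P : probability T R) (m n : nat) (X : nat -> T -> R) :
  (forall k, (m <= k < n)%N -> X k \in Lfun P 1) ->
  (forall k, (m <= k < n)%N -> 0 <= 'E_P[X k])%E ->
  (0 <= 'E_P[fun w => (\sum_(m <= k < n) X k w)%R])%E.
Proof.
move=> XL X0; rewrite -(fct_sumE _ _ X) -(big_map X predT id).
rewrite expectation_sum => [|_ /mapP[k + ->]]; last first.
  by rewrite mem_index_iota => /XL.
by rewrite big_map big_seq sume_ge0// => k; rewrite mem_index_iota => /X0.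
Qed.

Lemma Lfun1_expectation_defined d (T : measurableType d) (R : realType)
    (P : probability T R) (X : T -> R) :
  X \in Lfun P 1 -> expectation_defined P X.
Proof.
move=> XL; split; first exact: Lfun1_measurable XL.
left; rewrite ltey_eq expectation_fin_num//.
by apply/Lfun1_integrable/integrable_funrpos => //; apply/Lfun1_integrable.
Qed.

(** * Truncation of the weight *)

(** No integrability is needed: if both parts have infinite expectation, the
    two sides are the same conventional difference. *)
Lemma expectation_pos_neg d (T : measurableType d) (R : realType)
    (P : probability T R) (X : T -> R) :
  ('E_P[X] = 'E_P[X^\+] - 'E_P[X^\-])%E.
Proof.
rewrite unlock integralE; congr (_ - _)%E; apply: eq_integral => w _.
  by rewrite -[in LHS]/(EFin \o X) funerpos.
by rewrite -[in LHS]/(EFin \o X) funerneg.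
Qed.

(** Monotone convergence along the truncations min(V, n) of the weight. *)
Lemma cvg_expectation_truncate d (T : measurableType d) (R : realType)
    (P : probability T R) (U V : T -> R) :
  measurable_fun setT U -> measurable_fun setT V ->
  (forall w, 0 <= U w) -> (forall w, 0 <= V w) ->
  'E_P[fun w => (U w * Num.min (V w) n%:R)%R]%E @[n --> \oo]
    --> 'E_P[fun w => (U w * V w)%R]%E.
Proof.
move=> mU mV U0 V0; rewrite unlock.
pose g n w := (U w * Num.min (V w) n%:R)%:E.
rewrite [X in _ --> X](_ : _ = \int[P]_w limn (g^~ w))%E; last first.
  apply: eq_integral => w _; apply/esym/cvg_lim => //.
  apply: cvg_near_cst; near=> n; rewrite /g min_l//.
  by near: n; exact: nbhs_infty_ger.
apply: cvg_monotone_convergence => //.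
- move=> n; apply/measurable_EFinP/measurable_funM => //.
  exact: measurable_minr.
- by move=> n w _; rewrite lee_fin mulr_ge0// le_min V0 ler0n.
- move=> w _ m n mn; rewrite lee_fin ler_wpM2l// le_min ge_min lexx/=.
  by rewrite ge_min ler_nat mn orbT.
Unshelve. all: by end_near. Qed.

(** The sign of E[D V] for an unbounded weight V >= 0 can be tested on the
    truncations of V: only D is integrable, so the positive and negative parts
    of D V are compared in [0, +oo], where they are monotone limits. *)
Lemma expectation_ge0_truncate d (T : measurableType d) (R : realType)
    (P : probability T R) (D V : T -> R) :
  D \in Lfun P 1 -> measurable_fun setT V -> (forall w, 0 <= V w) ->
  (forall n, 0 <= 'E_P[fun w => (D w * Num.min (V w) n%:R)%R])%E ->
  expectation_defined P (fun w => D w * V w) ->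
  (0 <= 'E_P[fun w => (D w * V w)%R])%E.
Proof.
move=> DL mV V0 H [_ fin].
have mD := Lfun1_measurable DL.
have posM (W : T -> R) : (forall w, 0 <= W w) ->
    (fun w => D w * W w)^\+ = (fun w => D^\+ w * W w).
  by move=> W0; apply/funext => w; rewrite /funrpos maxr_pMl// mul0r.
have negM (W : T -> R) : (forall w, 0 <= W w) ->
    (fun w => D w * W w)^\- = (fun w => D^\- w * W w).
  by move=> W0; apply/funext => w; rewrite /funrneg maxr_pMl// mul0r mulNr.
have min0 n w : 0 <= Num.min (V w) n%:R by rewrite le_min V0 ler0n.
have E0 (W : T -> R) : (forall w, 0 <= W w) -> (0 <= 'E_P[W])%E.
  exact: expectation_ge0.
rewrite expectation_pos_neg posM// negM//.
rewrite sube_ge0; last first.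
  rewrite posM// negM// in fin.
  by apply/orP; case: fin => ?; [right|left]; rewrite ge0_fin_numE// E0// => w;
    rewrite mulr_ge0.
have cn := cvg_expectation_truncate (P := P) (U := D^\-) (V := V)
  (measurable_funrneg mD) mV (funrneg_ge0 _) V0.
have cp := cvg_expectation_truncate (P := P) (U := D^\+) (V := V)
  (measurable_funrpos mD) mV (funrpos_ge0 _) V0.
rewrite -(cvg_lim _ cn)// -(cvg_lim _ cp)//.
apply: lee_lim; [by apply/cvg_ex; eexists; exact: cn|
  by apply/cvg_ex; eexists; exact: cp|].
apply: nearW => n; have := H n.
rewrite expectation_pos_neg posM// negM// sube_ge0//.
apply/orP; right; rewrite expectation_fin_num//.
apply: (Lfun1M_bounded (c := n%:R)).
- by apply/Lfun1_integrable/integrable_funrpos => //; apply/Lfun1_integrable.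
- exact: measurable_minr.
- by move=> w; rewrite ger0_norm// ge_min lexx orbT.
Qed.

(** * Stopping times *)

Lemma measurable_time_le d (T : measurableType d) (R : realType)
    (S : nat -> T -> R) (tau : T -> option nat) (j : nat) :
  (forall n, (1 <= n)%N -> measurable_fun setT (S n)) ->
  stopping_time S tau -> measurable [set w | time_le (tau w) j].
Proof.
move=> mS [tau0 tauj]; case: j => [|j].
  rewrite [X in measurable X](_ : _ = set0)//; apply/seteqP; split => // w /=.
  by have := tau0 w; case: (tau w) => [[|n]|].
have := tauj j.+1 isT; apply: smallest_sub => //.
  exact: sigma_algebra_measurable.
rewrite -bigcup_mkord_ord => A [i _] [B mB <-].
exact: mS.
Qed.

Lemma measurable_time_ge d (T : measurableType d) (R : realType)
    (S : nat -> T -> R) (tau : T -> option nat) (i : nat) :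
  (forall n, (1 <= n)%N -> measurable_fun setT (S n)) ->
  stopping_time S tau -> measurable [set w | time_ge (tau w) i].
Proof.
move=> mS htau; case: i => [|i].
  rewrite [X in measurable X](_ : _ = setT)//; apply/seteqP; split => // w _ /=.
  by case: (tau w).
rewrite [X in measurable X](_ : _ = ~` [set w | time_le (tau w) i]).
  exact/measurableC/(measurable_time_le _ mS htau).
apply/seteqP; split=> w /=; case: (tau w) => [n|]//=.
  by rewrite ltnNge => /negP.
by move=> /negP; rewrite ltnNge.
Qed.

(** Nothing is assumed of S_0, which is harmless because a stopping time never
    takes the value 0. *)
Lemma measurable_stopped d (T : measurableType d) (R : realType)
    (S : nat -> T -> R) (tau : T -> option nat) :
  (forall n, (1 <= n)%N -> measurable_fun setT (S n)) ->
  stopping_time S tau -> measurable_fun setT (stopped S tau).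
Proof.
move=> mS htau.
(* The index 0, free because tau <> 0, is used for the event tau = oo. *)
pose E (n : nat) := [set w | tau w = if n is 0%N then None else Some n].
have ET : \bigcup_n E n = [set: T].
  apply/seteqP; split => // w _; have := htau.1 w.
  case tw : (tau w) => [[|n]|]// _; first by exists n.+1.
  by exists 0%N.
have mE n : measurable (E n).
  case: n => [|n].
    rewrite [E 0%N](_ : _ = ~` \bigcup_j [set w | time_le (tau w) j]).
      apply/measurableC/bigcup_measurable => j _.
      exact: measurable_time_le mS htau.
    apply/seteqP; split => w; rewrite /E /=.
      by move=> tw [j _] /=; rewrite tw.
    by case tw : (tau w) => [n|]// []; exists n => //=; rewrite tw /=.
  rewrite [E n.+1](_ : _ = [set w | time_le (tau w) n.+1] `&`
                           [set w | time_ge (tau w) n.+1]).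
    by apply: measurableI; [exact: measurable_time_le mS htau|
                            exact: measurable_time_ge mS htau].
  apply/seteqP; split => w; rewrite /E /=.
    by move=> ->/=; rewrite leqnn.
  by case: (tau w) => [m|]/= [mn nm] //; rewrite (@anti_leq m n.+1)// mn.
rewrite -ET; apply/measurable_fun_bigcup => // -[|n].
  apply: (eq_measurable_fun (cst (0 : R))) => // w; rewrite inE /stopped.
  by rewrite /E/= => ->.
apply: (eq_measurable_fun (S n.+1)) => [w|].
  by rewrite inE /stopped /E/= => ->.
by apply: measurable_funTS; exact: mS.
Qed.

(** The terms with k >= tau vanish and the others telescope. *)
Lemma stopped_telescope (T : Type) (R : realType) (S : nat -> T -> R)
    (tau : T -> option nat) (r M : nat) (w : T) :
  time_ge (tau w) r -> time_le (tau w) M ->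
  stopped S tau w - S r w =
  \sum_(r <= k < M) (S k.+1 w - S k w) * \1_[set v | time_ge (tau v) k.+1] w.
Proof.
rewrite /stopped; case tw : (tau w) => [n|]//= rn nM.
rewrite (big_cat_nat rn nM)/= [X in _ = _ + X]big_nat [X in _ = _ + X]big1 ?addr0.
  rewrite -(telescope_sumr (S^~ w) rn); apply: eq_big_nat => k /andP[_ kn].
  by rewrite indicE mem_set ?mulr1//= tw.
move=> k /andP[nk _]; rewrite indicE memNset ?mulr0//= tw /=.
by apply/negP; rewrite -leqNgt.
Qed.

(** * The optional sampling inequality *)

Lemma demimartingale_demisubmartingale d (T : measurableType d) (R : realType)
    (P : probability T R) (S : nat -> T -> R) :
  demimartingale P S -> demisubmartingale P S.
Proof. by move=> [SL H]; split=> // j j1 f mf ndf _; exact: H. Qed.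

(** For k >= r the weight 1_A f(S_r) is admissible at time k, as a product of
    nonnegative nondecreasing functions of S_1, ..., S_k. *)
Lemma demisubmartingale_increment_ge0 d (T : measurableType d) (R : realType)
    (P : probability T R) (S : nat -> T -> R) (r k : nat) (A : set T)
    (f : R -> R) :
  demisubmartingale P S -> (1 <= r <= k)%N -> measurable_fun setT f ->
  {homo f : x y / x <= y} -> (forall x, 0 <= f x) ->
  indic_nondecreasing_function_of S k A ->
  let X := fun w => (S k.+1 w - S k w) * \1_A w * f (S r w) in
  expectation_defined P X -> (0 <= 'E_P[X])%E.
Proof.
move=> [SL dS] /andP[r1 rk] mf ndf f0 [h [mh ndh Ah]] X.
(* S_r is the coordinate of index r - 1 of (S_1, ..., S_k).  The function h
   equals an indicator only on the values taken by the history and may be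
   negative elsewhere, hence its positive part in g. *)
have r1k : (r.-1 < k)%N by rewrite prednK.
pose g (x : k.-tuple R) := Num.max (h x) 0 * f (tnth x (Ordinal r1k)).
have -> : X = fun w => (S k.+1 w - S k w) * g (history S k w).
  apply/funext => w; rewrite /X /g -Ah -mulrA tnth_mktuple /= prednK//.
  by rewrite max_l// indicE ler0n.
apply: dS; first exact: leq_trans rk.
- apply: measurable_funM; first exact: measurable_maxr.
  by apply: measurableT_comp => //; exact: measurable_tnth.
- move=> x y xy; apply: ler_pM => //; first by rewrite le_max lexx orbT.
    by rewrite ge_max !le_max ndh// lexx orbT.
  exact/ndf/xy.
- by move=> x; rewrite mulr_ge0// le_max lexx orbT.
Qed.

Unset Implicit Arguments.
Set Strict Implicit.

Theorem theorem2p5 (d : measure_display) (T : measurableType d) (R : realType)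
    (P : probability T R) (S : nat -> T -> R)
    (hS : demimartingale P S \/ demisubmartingale P S)
    (r M : nat) (hr : (1 <= r)%N) (hrM : (r < M)%N)
    (tau : T -> option nat) (htau : stopping_time S tau)
    (hbnd : {ae P, forall w, time_ge (tau w) r && time_le (tau w) M})
    (hmono : forall i : nat, (r.+1 <= i <= M)%N ->
       indic_nondecreasing_function_of S i.-1 [set w | time_ge (tau w) i]) :
  demisubmartingale_pair P (S r) (stopped S tau) /\
  ('E_P[S r] <= 'E_P[stopped S tau])%E.
Proof.
have dS : demisubmartingale P S.
  by case: hS => // /demimartingale_demisubmartingale.
have SL := dS.1.
have mS n : (1 <= n)%N -> measurable_fun setT (S n).
  by move=> /SL /Lfun1_measurable.
have mtau := measurable_stopped mS htau.
pose A i := [set w | time_ge (tau w) i].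
have mA i : measurable (A i) by exact: measurable_time_ge mS htau.
pose inc k w := (S k.+1 w - S k w) * \1_(A k.+1) w.
have incL k : (r <= k)%N -> inc k \in Lfun P 1.
  move=> rk; apply: (Lfun1M_bounded (c := 1)).
  - by apply: (@rpredB _ _ (S k.+1) (S k)); rewrite SL// (leq_trans hr).
  - exact: measurable_indic.
  - by move=> w; rewrite indicE ger0_norm ?ler0n// lern1 leq_b1.
have sumL : (fun w => \sum_(r <= k < M) inc k w) \in Lfun P 1.
  by apply: Lfun1_sum => k /andP[rk _]; exact: incL.
have diffE : {ae P, forall w,
    stopped S tau w - S r w = \sum_(r <= k < M) inc k w}.
  by apply: filterS hbnd => w /andP[rw wM]; exact: stopped_telescope.
have mdiff : measurable_fun setT (fun w => stopped S tau w - S r w).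
  by apply: measurable_funB => //; exact: mS.
have diffL : (fun w => stopped S tau w - S r w) \in Lfun P 1.
  exact: Lfun1_ae_eq diffE.
have tauL : stopped S tau \in Lfun P 1.
  rewrite [stopped S tau](_ : _ = (fun w => stopped S tau w - S r w) + S r).
    by rewrite rpredD// SL.
  by apply/funext => w /=; rewrite fctE subrK.
(* The inequality for a weight bounded by c, where all terms are integrable. *)
have main (f : R -> R) (c : R) : measurable_fun setT f ->
    {homo f : x y / x <= y} -> (forall x, 0 <= f x) -> (forall x, f x <= c) ->
    (0 <= 'E_P[fun w => ((stopped S tau w - S r w) * f (S r w))%R])%E.
  move=> mf ndf f0 fc.
  have mfS : measurable_fun setT (fun w => f (S r w)).
    by apply: measurableT_comp => //; exact: mS.
  have incfL k : (r <= k)%N -> (fun w => inc k w * f (S r w)) \in Lfun P 1.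
    move=> rk; apply: (Lfun1M_bounded (c := c)) => //; first exact: incL.
    by move=> w; rewrite ger0_norm.
  rewrite (@expectation_ae_eq _ _ _ _ _
    (fun w => \sum_(r <= k < M) inc k w * f (S r w))).
  - apply: expectation_sum_ge0 => k /andP[rk kM]; first exact: incfL.
    apply: demisubmartingale_increment_ge0 => //; first by rewrite hr.
      by apply: (hmono k.+1); rewrite !ltnS rk.
    exact/Lfun1_expectation_defined/incfL.
  - exact: measurable_funM.
  - apply/(@Lfun1_measurable _ _ _ P)/Lfun1_sum => k /andP[rk _].
    exact: incfL.
  - by apply: filterS diffE => w ->; rewrite big_distrl.
split; last first.
  have := main (cst 1) 1 (measurable_cst _) (fun _ _ _ => lexx _)
    (fun _ => ler01) (fun _ => lexx _).
  under eq_fun do rewrite mulr1.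
  rewrite (expectationB tauL (SL r hr)) sube_ge0//.
  by rewrite expectation_fin_num// SL.
split=> // [|f mf ndf f0 X Xdef]; first exact: SL.
apply: expectation_ge0_truncate => //.
- by apply: measurableT_comp => //; exact: mS.
- move=> n; apply: (main (fun x => Num.min (f x) n%:R) n%:R).
  + exact: measurable_minr.
  + by move=> x y xy; rewrite le_min !ge_min ndf// lexx orbT.
  + by move=> x; rewrite le_min f0 ler0n.
  + by move=> x; rewrite ge_min lexx orbT.
Qed.
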